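(* Let $(X,p)$ be a finitely typed generalised partial metric space. Then the categorical topology on $(X,p)$ is identical to the (categorical) topology on the generalised metric space $(X,p_0)$, where $p_0(y,x):=p(y,x)-p(x,x)$.
   Context: Here $\vee$ denotes the maximum (in the natural order) of elements of $[0,\infty]$. A generalised partial metric space $(X,p)$ is a set $X$ with a function $p\colon X\times X\to[0,\infty]$ such that $p(y,x)\ge p(x,x)\vee p(y,y)$ and $p(z,y)-p(y,y)+p(y,x)\ge p(z,x)$ for all $x,y,z\in X$. It is finitely typed if $p(x,x)<\infty$ for all $x\in X$ (but $p(x,y)=\infty$ is allowed for $x\neq y$). A generalised metric space $(X,d)$ is the special case with $d(x,x)=0$ for all $x$, i.e. $d\colon X\times X\to[0,\infty]$ with $d(x,x)=0$ and $d(z,y)+d(y,x)\ge d(z,x)$ (not necessarily symmetric, separated or finite). The categorical topology on a finitely typed generalised partial metric space is the topology given by the following (topological) closure operator: for $S\subseteq X$, $\overline{S}$ is the largest $T$ with $S\subseteq T\subseteq X$ such that $p(y,x)=\inf_{s\in S}\big(p(y,s)-p(s,s)+p(s,x)\big)$ for all $x,y\in T$; equivalently, $x\in\overline{S}$ iff $p(x,x)\ge\inf_{s\in S}\big(p(x,s)-p(s,s)+p(s,x)\big)$ (with $\inf\emptyset=\infty$). In particular, for a generalised metric space $(X,d)$: $x\in\overline{S}$ iff $0\ge\inf_{s\in S}\big(d(x,s)+d(s,x)\big)$. *)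

(* Defs.v *)
From HB Require Import structures.
From mathcomp Require Import all_boot all_order all_algebra.
From mathcomp Require Import all_classical all_reals.
From mathcomp Require Import ereal topology.
From mathcomp Require Import lra.

Set Implicit Arguments.
Unset Strict Implicit.
Unset Printing Implicit Defensive.
Import Order.TTheory GRing.Theory Num.Theory.

Local Open Scope classical_set_scope.
Local Open Scope ring_scope.
Local Open Scope ereal_scope.

(* If p y y = +oo then p y x = +oo by [gpm_self], and the triangle inequality
   holds whatever value is given to +oo - +oo in [0, +oo]; the guard avoids
   the value -oo that MathComp-Analysis gives to it. *)
Record gpmetric (R : realType) (X : Type) := GPMetric {
  gpm_fun :> X -> X -> \bar R ;
  gpm_ge0 : forall y x, 0 <= gpm_fun y x ;
  gpm_self : forall y x,
    maxe (gpm_fun x x) (gpm_fun y y) <= gpm_fun y x ;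
  gpm_triangle : forall x y z, gpm_fun y y \is a fin_num ->
    gpm_fun z x <= gpm_fun z y - gpm_fun y y + gpm_fun y x }.

Record ftgpmetric (R : realType) (X : Type) := FTGPMetric {
  ftgpm_gpm :> gpmetric R X ;
  ftgpm_fin : forall x, ftgpm_gpm x x < +oo }.

Record gmetric (R : realType) (X : Type) := GMetric {
  gm_gpm :> gpmetric R X ;
  gm_refl : forall x, gm_gpm x x = 0 }.

Lemma gm_fin (R : realType) (X : Type) (d : gmetric R X) x : d x x < +oo.
Proof. by rewrite gm_refl ltry. Qed.

Definition ftgpm_of_gm (R : realType) (X : Type) (d : gmetric R X) :
  ftgpmetric R X := FTGPMetric (@gm_fin R X d).
Coercion ftgpm_of_gm : gmetric >-> ftgpmetric.

Section closure.
Variables (R : realType) (X : Type) (p : ftgpmetric R X).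
Implicit Types (S T : set X) (x y s t : X).

(* [ereal_inf set0 = +oo] *)
Definition cat_dense S T := S `<=` T /\
  forall x y, T x -> T y ->
    p y x = ereal_inf [set p y s - p s s + p s x | s in S].

(* The union of all candidates; it is itself a candidate, hence the largest
   one ([cat_closure_largest]). *)
Definition cat_closure S : set X := \bigcup_(T in cat_dense S) T.

Let pfin x : p x x \is a fin_num.
Proof. by rewrite ge0_fin_numE ?gpm_ge0// ftgpm_fin. Qed.

Let tri x y z : p z x <= p z y - p y y + p y x.
Proof. exact: gpm_triangle. Qed.

Let near_closure S x := forall e : R, (0 < e)%R ->
  exists2 s, S s & p x s - p s s + p s x < p x x + e%:E.

Let inf_nearP S x :
  ereal_inf [set p x s - p s s + p s x | s in S] <= p x x <-> near_closure S x.
Proof.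
split=> [h e e0|h].
  have /ereal_inf_lt[_ [s Ss <-] lt] :
      ereal_inf [set p x s - p s s + p s x | s in S] < p x x + e%:E.
    apply: le_lt_trans h _.
    by rewrite -[p x x]fineK// -EFinD lte_fin ltrDl.
  by exists s.
apply/lee_addgt0Pr => e /h[s Ss lt].
by apply: ge_ereal_inf; exists (p x s - p s s + p s x); [exists s|exact: ltW].
Qed.

Let near_dense S : cat_dense S (near_closure S).
Proof.
split=> [s Ss e e0|x y nx ny].
  by exists s => //; move: (pfin s) => /fineK <-; rewrite -?EFinB -?EFinD
    lte_fin; lra.
apply/eqP; rewrite eq_le; apply/andP; split.
  by apply: le_ereal_inf_tmp => _ [s Ss <-]; exact: tri.
apply/lee_addgt0Pr => e /nx[s Ss lt].
apply: ge_ereal_inf; exists (p y s - p s s + p s x); first by exists s.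
have := tri s x y; move: lt (pfin x) (pfin s).
move: (gpm_ge0 p x s) (gpm_ge0 p s x) (gpm_ge0 p y x) (gpm_ge0 p y s).
case: (p x s) (p s x) (p y x) (p y s) (p x x) (p s s)
  => [a| |] [b| |] [c| |] [f| |] [g| |] [h| |] //=.
all: rewrite -?EFinB -?EFinD ?lte_fin ?lee_fin ?leey //.
lra.
Qed.

Lemma cat_closureP S x : cat_closure S x <->
  ereal_inf [set p x s - p s s + p s x | s in S] <= p x x.
Proof.
split=> [[T [_ TE] Tx]|/inf_nearP nx]; first by rewrite -(TE x x Tx Tx).
by exists (near_closure S) => //; exact: near_dense.
Qed.

Lemma cat_closure_largest S : cat_dense S (cat_closure S) /\
  forall T, cat_dense S T -> T `<=` cat_closure S.
Proof.
split; last by move=> T ST x Tx; exists T.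
suff -> : cat_closure S = near_closure S by exact: near_dense.
by apply/seteqP; split => x; [move=> /cat_closureP/inf_nearP|
  move=> /inf_nearP/cat_closureP].
Qed.

Let closure_near S x : cat_closure S x <-> near_closure S x.
Proof. by rewrite cat_closureP inf_nearP. Qed.

Lemma sub_cat_closure S : S `<=` cat_closure S.
Proof. by case: (cat_closure_largest S) => -[]. Qed.

Lemma cat_closureS S S' : S `<=` S' -> cat_closure S `<=` cat_closure S'.
Proof.
move=> SS' x /closure_near nx; apply/closure_near => e /nx[s Ss ?].
by exists s => //; exact: SS'.
Qed.

Lemma cat_closure0 : cat_closure set0 = set0.
Proof.
by apply/seteqP; split => // x /closure_near /(_ _ ltr01)[].
Qed.

Lemma cat_closureU S S' :
  cat_closure (S `|` S') = cat_closure S `|` cat_closure S'.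
Proof.
apply/seteqP; split => [x /closure_near nx|x []]; last 2 first.
- by apply: cat_closureS; left.
- by apply: cat_closureS; right.
apply: contrapT => /not_orP[/closure_near/existsNP[e1 /not_implyP[e10 h1]]].
move=> /closure_near/existsNP[e2 /not_implyP[e20 h2]].
have e0 : (0 < Num.min e1 e2)%R by rewrite lt_min e10.
have [s Ss lt] := nx _ e0.
case: Ss => Ss; [apply: h1|apply: h2]; exists s => //; apply: lt_le_trans lt _;
  by rewrite leeD2l// lee_fin ge_min lexx ?orbT.
Qed.

Lemma cat_closureK S : cat_closure (cat_closure S) = cat_closure S.
Proof.
apply/seteqP; split; last exact: sub_cat_closure.
move=> x /closure_near nx; apply/closure_near => e e0.
have e20 : (0 < e / 2)%R by lra.
have [t /closure_near /(_ _ e20)[s Ss lts] ltt] := nx _ e20.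
exists s => //; have := tri s t x; have := tri x t s; move: lts ltt.
move: (pfin x) (pfin s) (pfin t) (gpm_ge0 p x s) (gpm_ge0 p s x).
move: (gpm_ge0 p x t) (gpm_ge0 p t x) (gpm_ge0 p s t) (gpm_ge0 p t s).
case: (p x x) (p s s) (p t t) => [a| |] [b| |] [c| |] //=.
case: (p x t) (p t x) => [x1| |] [x2| |] //=.
case: (p s t) (p t s) => [y1| |] [y2| |] //=.
case: (p x s) (p s x) => [z1| |] [z2| |] //=.
rewrite -?EFinB -?EFinD ?lte_fin ?lee_fin; lra.
Qed.

End closure.

Definition cat_top (R : realType) (X : Type) (p : ftgpmetric R X) : Type := X.

Section cat_topology.
Variables (R : realType) (X : Type) (p : ftgpmetric R X).

Definition cat_open (U : set (cat_top p)) := cat_closure p (~` U) = ~` U.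

Let cat_openT : cat_open setT.
Proof. by rewrite /cat_open setCT cat_closure0. Qed.

Let cat_openI : setI_closed cat_open.
Proof.
by move=> U V; rewrite /cat_open setCI cat_closureU => -> ->.
Qed.

Let cat_open_bigU (I : Type) (f : I -> set (cat_top p)) :
  (forall i, cat_open (f i)) -> cat_open (\bigcup_i f i).
Proof.
move=> of_; apply/seteqP; split; last exact: sub_cat_closure.
rewrite setC_bigcup => x cx i _; rewrite -(of_ i).
by apply: cat_closureS cx => y; apply.
Qed.

HB.instance Definition _ := gen_eqMixin (cat_top p).
HB.instance Definition _ := gen_choiceMixin (cat_top p).
HB.instance Definition _ := isOpenTopological.Build (cat_top p)
  cat_openT cat_openI cat_open_bigU.

Lemma cat_top_openE (U : set (cat_top p)) : open U <-> cat_open U.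
Proof. by []. Qed.

Lemma cat_top_closureE (S : set (cat_top p)) : closure S = cat_closure p S.
Proof.
rewrite closureE; apply/seteqP; split => [|x cx T [cT ST]].
  apply: smallest_sub; last exact: sub_cat_closure.
  by rewrite -openC; rewrite cat_top_openE /cat_open setCK cat_closureK.
move: cT; rewrite -openC cat_top_openE /cat_open setCK => <-.
exact: cat_closureS cx.
Qed.

End cat_topology.

Definition categorical_topology (R : realType) (X : Type)
  (p : ftgpmetric R X) : set (set X) := @open (cat_top p).

(* Main.v *)
Require Import Defs.
From mathcomp Require Import all_boot all_order all_algebra.
From mathcomp Require Import all_classical all_reals.
From mathcomp Require Import ereal topology.

(** The correction term in the round trip p x s - p s s + p s x through s is
    exactly what the passage to p0 needs: the same round trip for p0 has length
      (p x s - p s s) + (p s x - p x x),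
    that is, the round trip for p shortened by the finite constant p x x
    ([untype_round_trip]). An infimum commutes with a finite shift
    ([ereal_infB]), so the round trips from x through S come arbitrarily close
    to p x x for p if and only if they come arbitrarily close to 0 = p0 x x for
    p0. Hence both spaces have the same closure operator
    ([cat_closure_untype]), and with it the same topology. *)

Set Implicit Arguments.
Unset Strict Implicit.
Unset Printing Implicit Defensive.
Import Order.TTheory GRing.Theory Num.Theory.

Local Open Scope classical_set_scope.
Local Open Scope ereal_scope.

(** Finiteness of c makes subtracting c an order automorphism of the extended
    reals, and these preserve infima, including the value +oo on the empty
    family. *)
Lemma ereal_infB (R : realType) (I : Type) (S : set I) (f : I -> \bar R)
    (c : \bar R) : c \is a fin_num ->
  ereal_inf [set f s - c | s in S] = ereal_inf [set f s | s in S] - c.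
Proof.
move=> cfin; apply/eqP; rewrite eq_le; apply/andP; split.
  rewrite leeBrDr//; apply: le_ereal_inf_tmp => _ [s Ss <-].
  by rewrite -leeBrDr//; apply: ge_ereal_inf; exists (f s - c); first exists s.
apply: le_ereal_inf_tmp => _ [s Ss <-].
by apply: leeB => //; apply: ge_ereal_inf; exists (f s); first exists s.
Qed.

Section untype.
Variables (R : realType) (X : Type) (p : ftgpmetric R X).

Let pfin x : p x x \is a fin_num.
Proof. by rewrite ge0_fin_numE ?gpm_ge0// ftgpm_fin. Qed.

(** The name refers to p x x as the type of x. *)
Definition untype_fun (y x : X) : \bar R := p y x - p x x.

Let untype_refl x : untype_fun x x = 0.
Proof. exact: subee. Qed.

Let untype_ge0 y x : 0 <= untype_fun y x.
Proof.
rewrite /untype_fun leeBrDr// add0e; apply: le_trans (gpm_self p y x).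
by rewrite le_max lexx.
Qed.

Let untype_self y x :
  maxe (untype_fun x x) (untype_fun y y) <= untype_fun y x.
Proof. by rewrite !untype_refl maxxx. Qed.

(** As p0 y y = 0, the p y y inside p0 z y takes over the role of the correction
    term: this is the triangle inequality of p with p x x subtracted from both
    sides. *)
Let untype_triangle x y z : untype_fun y y \is a fin_num ->
  untype_fun z x <= untype_fun z y - untype_fun y y + untype_fun y x.
Proof.
move=> _; rewrite untype_refl sube0 /untype_fun addeA leeB//.
exact: gpm_triangle.
Qed.

Definition untype : gmetric R X := @GMetric R X
  (GPMetric untype_ge0 untype_self untype_triangle) untype_refl.

Lemma untype_round_trip x s :
  untype x s - untype s s + untype s x = (p x s - p s s + p s x) - p x x.
Proof. by rewrite gm_refl sube0 addeA. Qed.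

Lemma cat_closure_untype (S : set X) : cat_closure untype S = cat_closure p S.
Proof.
apply/seteqP; split=> x /cat_closureP h; apply/cat_closureP; move: h;
  rewrite gm_refl (eq_imagel (fun s _ => untype_round_trip x s)) ereal_infB//;
  by rewrite leeBlDr// add0e.
Qed.

End untype.

Theorem proposition5p1p2 (R : realType) (X : Type) (p : ftgpmetric R X) :
  exists2 p0 : gmetric R X,
    (forall y x : X, p0 y x = (p y x - p x x)%E) &
    categorical_topology p = categorical_topology p0.
Proof.
exists (untype p) => //.
(* Openness of U says that the complement of U is a fixed point of closure. *)
apply/funext => U; apply/propext.
rewrite /categorical_topology (@cat_top_openE _ _ p) (@cat_top_openE _ _ (untype p)).
by rewrite /cat_open cat_closure_untype.
Qed.
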